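(* Let $F$ be a graph with maximum degree at least two, and for each $n\ge 1$ let $\mathcal{F}_n$ be the down-set of $F$-free graphs on vertex-set $[n]$. Then, as $n\to\infty$ (with $F$ fixed), the expectation threshold $q(\mathcal{F}_n)$, the fractional expectation threshold $q_{\mathrm f}(\mathcal{F}_n)$ and the threshold $p_{\mathrm c}(\mathcal{F}_n)$ satisfy $$q(\mathcal{F}_n),\; q_{\mathrm f}(\mathcal{F}_n)=\Omega\bigl(n^{-1/m_2(F)}\bigr)\qquad\text{and}\qquad p_{\mathrm c}(\mathcal{F}_n)=\Theta\bigl(n^{-1/m(F)}\bigr),$$ with the graph-densities $$m_2(F):=\max_{J\subseteq F:\, v_J\ge 3}\frac{e_J-1}{v_J-2}\qquad\text{and}\qquad m(F):=\max_{J\subseteq F:\, v_J\ge 1}\frac{e_J}{v_J}.$$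
   Context: Graphs are finite and simple, and $[n]=\{1,\dots,n\}$. For a graph $J$, $v_J$ and $e_J$ denote its numbers of vertices and edges; in the definitions of $m_2(F)$ and $m(F)$, $J\subseteq F$ ranges over subgraphs of $F$. A graph is $F$-free if it contains no (not necessarily induced) subgraph isomorphic to $F$. A graph on vertex-set $[n]$ is identified with its edge set, i.e. with a subset of $X=\binom{[n]}{2}$, so $\mathcal{F}_n\subseteq 2^X$. The constants implicit in $\Omega$ and $\Theta$ may depend on $F$. Let $X$ be a finite set. A family $\mathcal{F}\subseteq 2^X$ is a down-set if $A\in\mathcal{F}$ and $B\subseteq A$ imply $B\in\mathcal{F}$. The cases $\mathcal{F}=\emptyset$ and $\mathcal{F}=2^X$ are excluded. For $p\in[0,1]$, $\mu_p$ denotes the product measure on $2^X$ given by $\mu_p(S)=p^{|S|}(1-p)^{|X\setminus S|}$ for all $S\subseteq X$, and $\mu_p(\mathcal{F})=\sum_{S\in\mathcal{F}}\mu_p(S)$. For a down-set $\mathcal{F}$: - The threshold $p_{\mathrm c}(\mathcal{F})$ is the unique $p\in[0,1]$ for which $\mu_p(\mathcal{F})=1/2$. - The expectation threshold $q(\mathcal{F})$ is the smallest $p\in[0,1]$ for which there exists $\mathcal{G}\subseteq 2^X$ with $\sum_{S\in\mathcal{G}}(1-p)^{|X\setminus S|}\le 1/2$ and $\mathcal{F}\subseteq\mathcal{G}^{\downarrow}$, where $\mathcal{G}^{\downarrow}=\bigcup_{S\in\mathcal{G}}\{T: T\subseteq S\}$. - The fractional expectation threshold $q_{\mathrm f}(\mathcal{F})$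 is the smallest $p\in[0,1]$ for which there exists a function $\lambda:2^X\to[0,\infty)$ with $\sum_{S\subseteq X}\lambda(S)(1-p)^{|X\setminus S|}\le 1/2$ and $\sum_{S\supseteq A}\lambda(S)\ge 1$ for all $A\in\mathcal{F}$ (the sum being over $S\subseteq X$ with $S\supseteq A$). The convention $0^0=1$ is used. *)

(* Defs.v *)
From mathcomp Require Import all_boot all_order all_algebra.
From mathcomp Require Import all_classical all_reals all_analysis.

Set Implicit Arguments.
Unset Strict Implicit.
Unset Printing Implicit Defensive.

Import Order.TTheory GRing.Theory Num.Theory.
Import numFieldNormedType.Exports.

Local Open Scope ring_scope.

(* X = the 2-element subsets of V; a graph on V is a set of edges, with V as
   its set of vertices, so isolated vertices count. *)
Definition edge (V : finType) : finType := {e : {set V} | #|e| == 2%N}.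

Definition graph (V : finType) := {set edge V}.

Definition max_degree (V : finType) (G : graph V) : nat :=
  \max_(v : V) #|[set e in G | v \in val e]%SET|.

(* J = (J.1, J.2) lists the vertices and the edges of a subgraph: v_J = #|J.1|,
   e_J = #|J.2|. *)
Definition subgraph (V : finType) (G : graph V) (J : {set V} * graph V) : bool :=
  (J.2 \subset G) && [forall e in J.2, val e \subset J.1].

(* The graph F is isomorphic to the graph with vertices J.1 and edges J.2. *)
Definition isomorphic (V W : finType) (F : graph V) (J : {set W} * graph W)
    : bool :=
  [exists f : {ffun V -> W},
    [&& injectiveb f, (f @: [set: V])%SET == J.1
      & [set f @: val e | e : edge V in F]%SET == [set val e | e : edge W in J.2]%SET]].

Definition F_free (V W : finType) (F : graph V) (G : graph W) : bool :=
  ~~ [exists J : {set W} * graph W, subgraph G J && isomorphic F J].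

(* The vertex-set [n] is rendered as 'I_n. *)
Definition free_family (V : finType) (F : graph V) (n : nat)
    : {set graph 'I_n} :=
  [set G | F_free F G]%SET.

Definition down_set (X : finType) (A : {set {set X}}) : Prop :=
  forall S T : {set X}, S \in A -> T \subset S -> T \in A.

Lemma free_family_down_set (V : finType) (F : graph V) (n : nat) :
  down_set (free_family F n).
Proof.
move=> S T; rewrite !inE => freeS TS.
apply: contra freeS => /existsP[J /andP[/andP[JT JV] FJ]].
apply/existsP; exists J; rewrite FJ andbT /subgraph JV andbT.
exact: fintype.subset_trans JT TS.
Qed.

(* In both maxima the default 0 is harmless: a graph of maximum degree at least
   two has a subgraph on three vertices with at least two edges. *)
Definition density_m2 (R : realType) (V : finType) (F : graph V) : R :=
  \big[Num.max/0]_(J : {set V} * graph V | subgraph F J && (3 <= #|J.1|)%N)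
    ((#|J.2|%:R - 1) / (#|J.1|%:R - 2)).

Definition density_m (R : realType) (V : finType) (F : graph V) : R :=
  \big[Num.max/0]_(J : {set V} * graph V | subgraph F J && (1 <= #|J.1|)%N)
    (#|J.2|%:R / #|J.1|%:R).

Definition mu (R : realType) (X : finType) (p : R) (A : {set {set X}}) : R :=
  \sum_(S in A) p ^+ #|S| * (1 - p) ^+ #|~: S|.

(* The three thresholds are meant for down-sets other than set0 and setT, where
   the number described exists and is unique.  The junk value 0 is returned when
   there is no such number, e.g. for A = setT; free_family F n is setT only when
   n is less than the number of vertices of F. *)
Definition threshold (R : realType) (X : finType) (A : {set {set X}}) : R :=
  xget 0 [set p | 0 <= p <= 1 /\ mu p A = 1 / 2]%classic.

Definition smallest_of (R : realType) (B : set R) : R :=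
  xget 0 [set p | B p /\ lbound B p]%classic.

Definition down_closure (X : finType) (G : {set {set X}}) : {set {set X}} :=
  (\bigcup_(S in G) powerset S)%SET.

Definition expectation_threshold (R : realType) (X : finType)
    (A : {set {set X}}) : R :=
  smallest_of [set p : R | 0 <= p <= 1 /\
    exists G : {set {set X}},
      \sum_(S in G) (1 - p) ^+ #|~: S| <= 1 / 2 /\
      A \subset down_closure G]%classic.

Definition fractional_expectation_threshold (R : realType) (X : finType)
    (A : {set {set X}}) : R :=
  smallest_of [set p : R | 0 <= p <= 1 /\
    exists lambda : {set X} -> R,
      [/\ forall S, 0 <= lambda S,
          \sum_(S : {set X}) lambda S * (1 - p) ^+ #|~: S| <= 1 / 2
        & forall S, S \in A -> 1 <= \sum_(T : {set X} | S \subset T) lambda T]]%classic.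

(* Main.v *)
Require Import Defs.
From mathcomp Require Import all_boot all_order all_algebra.
From mathcomp Require Import all_classical all_reals all_analysis.
From mathcomp Require Import ring lra.

Import Order.TTheory GRing.Theory Num.Theory.
Import numFieldNormedType.Exports.
Local Open Scope classical_set_scope.
Local Open Scope ring_scope.

(** Expectation thresholds.  By weak duality, a random F-free graph A with
    P(A disjoint from T) <= (1 - p)^|T| for all sets T of edges forces
    q >= q_f >= p.  Take a densest J for m_2(F) and a random graph S of edge
    probability a small multiple of n^(-1/m_2(F)), and let A be what remains of
    S when a maximal family of edge-disjoint copies of J is deleted.  If A
    misses T, then many members of that family meet T, which is exponentially
    unlikely.

    Threshold.  The lower bound is the first moment of the number of copies of a
    densest J for m(F).  The upper bound is the second moment of the number of
    copies of F in which every vertex v of F is placed in its own class of about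
    n/v_F vertices: two such copies share exactly the edges of F spanned by the
    vertices on which their placements agree. *)

(** * Random subsets *)

Definition bernoulli_weight {R : realType} {X : finType} (p : R) (S : {set X}) : R :=
  p ^+ #|S| * (1 - p) ^+ #|~: S|%SET.

Lemma prodr_mem {R : realType} {X : finType} (D : {set X}) (a : R) :
  \prod_(i : X) (if i \in D then a else 1) = a ^+ #|D|.
Proof. by rewrite -big_mkcond prodr_const. Qed.

Lemma bernoulli_weight_ge0 {R : realType} {X : finType} (p : R) (S : {set X}) :
  0 <= p <= 1 -> 0 <= bernoulli_weight p S.
Proof.
by move=> /andP[p0 p1]; rewrite mulr_ge0 // exprn_ge0 // subr_ge0.
Qed.

(** Independence of the coordinates: distributivity expands the right-hand product into one term for
    each choice of the set of [i] that take the first summand. *)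
Lemma sum_bernoulli_prod {R : realType} {X : finType} (p : R) (f g : X -> R) :
  \sum_(S : {set X}) bernoulli_weight p S *
      \prod_i (if i \in S then f i else g i) =
  \prod_i (p * f i + (1 - p) * g i).
Proof.
rewrite bigA_distr; apply: eq_bigr => S _.
have -> : bernoulli_weight p S = \prod_i (if i \in S then p else 1 - p).
  rewrite /bernoulli_weight -!prodr_mem -big_split /=; apply: eq_bigr => i _.
  by rewrite !inE; case: ifP => _ /=; rewrite ?mulr1 ?mul1r.
by rewrite -big_split /=; apply: eq_bigr => i _; case: ifP.
Qed.

Lemma subset_prod {R : realType} {X : finType} (D S : {set X}) :
  (D \subset S)%:R = \prod_i (if i \in S then 1 else (i \notin D)%:R) :> R.
Proof.
have [/fintype.subsetP DS|/fintype.subsetPn[i iD iS]] := boolP (D \subset S).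
  rewrite big1 // => i _; case: ifPn => // iS.
  by have -> // : i \notin D; apply: contra iS; apply: DS.
by rewrite (bigD1 i) //= (negbTE iS) iD mul0r.
Qed.

Lemma sum_bernoulli_subset {R : realType} {X : finType} (p : R) (D : {set X}) :
  \sum_(S : {set X}) bernoulli_weight p S * (D \subset S)%:R = p ^+ #|D|.
Proof.
under eq_bigr do rewrite subset_prod.
rewrite sum_bernoulli_prod -prodr_mem; apply: eq_bigr => i _.
by case: (i \in D) => /=; ring.
Qed.

Lemma sum_bernoulli {R : realType} {X : finType} (p : R) :
  \sum_(S : {set X}) bernoulli_weight p S = 1.
Proof.
rewrite -(expr0 p) -(cards0 X) -sum_bernoulli_subset.
by apply: eq_bigr => S _; rewrite finset.sub0set mulr1.
Qed.

(** The expectation factors over the elements. An element of [D] contributes [p] or [p * x], both at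
    most [p]; an element of [T] outside [D] contributes exactly [1 - p * (1 - x)]. *)
Lemma sum_bernoulli_subset_expr {R : realType} {X : finType} (p x : R)
    (D T : {set X}) : 0 <= p <= 1 -> 0 <= x <= 1 ->
  \sum_(S : {set X}) bernoulli_weight p S *
      ((D \subset S)%:R * x ^+ #|T :&: S|%SET) <=
  p ^+ #|D| * (1 - p * (1 - x)) ^+ #|T :\: D|%SET.
Proof.
move=> /andP[p0 p1] /andP[x0 x1].
have E (S : {set X}) : (D \subset S)%:R * x ^+ #|T :&: S|%SET =
    \prod_i (if i \in S then (if i \in T then x else 1) else (i \notin D)%:R).
  rewrite subset_prod -prodr_mem -big_split /=; apply: eq_bigr => i _.
  by rewrite inE; case: (i \in S); rewrite ?andbT ?andbF ?mul1r ?mulr1.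
under eq_bigr do rewrite E.
rewrite sum_bernoulli_prod -!prodr_mem -big_split /=.
apply: ler_prod => i _; rewrite !inE.
case: (i \in D); case: (i \in T) => /=; rewrite ?mulr0 ?mulr1 ?mul1r.
- by apply/andP; split; nra.
- by apply/andP; split; nra.
- by apply/andP; split; nra.
- by apply/andP; split; nra.
Qed.

(** * Packings and spread random sets *)

(** Maximality is with respect to inclusion. The default is never reached, because the empty family
    is a packing. *)
Definition max_packing {X : finType} (H : {set {set X}}) (S : {set X}) :
    {set {set X}} :=
  odflt finset.set0
    [pick D | maxset (fun D => [&& D \subset H, finset.trivIset D & finset.cover D \subset S]) D].

Lemma max_packingP {X : finType} (H : {set {set X}}) (S : {set X}) :
  maxset (fun D => [&& D \subset H, finset.trivIset D & finset.cover D \subset S])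
    (max_packing H S).
Proof.
rewrite /max_packing; case: pickP => //= no.
have [|D] := @maxset_exists _
  (fun D => [&& D \subset H, finset.trivIset D & finset.cover D \subset S]) finset.set0.
  rewrite /finset.cover big_set0 !finset.sub0set andbT /=.
  by apply/finset.trivIsetP => A B; rewrite inE.
by move=> mD _; have := no D; rewrite /= mD.
Qed.

Definition residual {X : finType} (H : {set {set X}}) (S : {set X}) : {set X} :=
  (S :\: finset.cover (max_packing H S))%SET.

(** Such an [h] would be disjoint from the whole packing and could be added to it. By maximality it
    is already a member, hence disjoint from itself, which a non-empty set is not. *)
Lemma residual_avoids {X : finType} (H : {set {set X}}) (S h : {set X}) :
  h \in H -> (0 < #|h|)%N -> ~~ (h \subset residual H S).
Proof.
move=> hH h0; apply/negP; rewrite finset.subsetD => /andP[hS hC].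
have /maxsetP[/and3P[DH Dtriv DS] Dmax] := max_packingP H S.
set D := max_packing H S in DH Dtriv DS Dmax hC *.
suff E : (h |: D)%SET = D.
  have hD : h \in D by rewrite -E setU11.
  have hh : h \subset finset.cover D by apply: (finset.bigcup_sup h).
  case/card_gt0P: h0 => x xh; move/fintype.subsetP: hh => /(_ _ xh) xC.
  by move: hC; rewrite disjoint_sym => /disjointFr -/(_ _ xC); rewrite xh.
apply: Dmax; last exact: finset.subsetUr.
apply/and3P; split.
- by rewrite finset.subUset finset.sub1set hH.
- apply/finset.trivIsetP => A B /setU1P[->|AD] /setU1P[->|BD]; rewrite ?eqxx // => AB.
  + by apply: disjointWr hC; apply: (finset.bigcup_sup B).
  + rewrite disjoint_sym.
    by apply: disjointWr hC; apply: (finset.bigcup_sup A).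
  + by move/finset.trivIsetP: Dtriv; apply.
- apply/finset.bigcupsP => B /setU1P[->//|BD].
  by apply: fintype.subset_trans DS; apply: (finset.bigcup_sup B).
Qed.

Definition meeting {X : finType} (H : {set {set X}}) (T : {set X}) :
    {set {set X}} :=
  (\bigcup_(x in T) [set h in H | x \in h])%SET.

Lemma card_meeting {X : finType} (H : {set {set X}}) (T : {set X}) (N : nat) :
  (forall x, #|[set h in H | x \in h]%SET| <= N)%N ->
  (#|meeting H T| <= N * #|T|)%N.
Proof.
move=> HN; rewrite /meeting; apply: (@leq_trans (\sum_(x in T) #|[set h in H | x \in h]%SET|)).
  apply: (big_ind2 (fun (A : {set {set X}}) n => (#|A| <= n)%N)) => //.
    by rewrite cards0.
  by move=> A m B n Am Bn; apply: leq_trans (leq_card_setU _ _) (leq_add Am Bn).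
by rewrite mulnC -sum_nat_const; apply: leq_sum => x _; apply: HN.
Qed.

Lemma sum_subset_expr {R : realType} {Y : finType} (A : {set Y}) (y : R) :
  \sum_(D : {set Y} | D \subset A) y ^+ #|D| = (1 + y) ^+ #|A|.
Proof.
have := @bigA_distr R 0 1 *%R +%R Y (fun i => if i \in A then y else 0) (fun=> 1).
rewrite (eq_bigr (fun i => if i \in A then 1 + y else 1)); last first.
  by move=> i _ /=; case: ifP => _; rewrite ?add0r // [LHS]addrC.
rewrite prodr_mem => ->; rewrite [RHS](bigID (fun D : {set Y} => D \subset A)) /=.
rewrite [X in _ + X]big1 ?addr0.
  apply: eq_bigr => D DA; rewrite -prodr_mem; apply: eq_bigr => i _.
  by case: ifPn => // iD; rewrite (fintype.subsetP DA).
move=> D /fintype.subsetPn[i iD iA].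
by rewrite (bigD1 i) //= iD (negbTE iA) mul0r.
Qed.

(** Each element of [T :&: S] has been deleted, so it lies in a packing member that meets [T], and
    such a member covers at most [e] elements. *)
Lemma card_residual_meeting {X : finType} (H : {set {set X}}) (e : nat)
    (S T : {set X}) : (forall h, h \in H -> (#|h| <= e)%N) ->
  residual H S \subset (~: T)%SET ->
  (#|T :&: S|%SET <= e * #|max_packing H S :&: meeting H T|%SET)%N.
Proof.
move=> He RT; have /maxsetP[/and3P[DH Dtriv DS] _] := max_packingP H S.
set D := max_packing H S in DH Dtriv DS *.
apply: (@leq_trans #|finset.cover (D :&: meeting H T)%SET|).
  apply: subset_leq_card; apply/fintype.subsetP => x; rewrite inE => /andP[xT xS].
  have : x \notin residual H S.
    by apply/negP => xR; have := fintype.subsetP RT _ xR; rewrite inE xT.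
  rewrite inE xS andbT negbK => /bigcupP[h hD xh].
  apply/bigcupP; exists h => //; rewrite inE hD /=.
  by apply/bigcupP; exists x => //; rewrite inE xh (fintype.subsetP DH).
apply: leq_trans (leq_card_cover _) _.
rewrite mulnC -sum_nat_const; apply: leq_sum => h; rewrite inE => /andP[hD _].
by apply: He; apply: (fintype.subsetP DH).
Qed.

Lemma card_cover_trivIset {X : finType} (e : nat) (D : {set {set X}}) :
  (forall h, h \in D -> #|h| = e) -> finset.trivIset D ->
  #|finset.cover D| = (e * #|D|)%N.
Proof.
move=> De Dtriv; have [_ /eqP] := leq_card_cover D; rewrite Dtriv => /eqP/eqP ->.
by rewrite mulnC -sum_nat_const; apply: eq_bigr.
Qed.

Lemma expr_bernoulli_bound {R : realType} (y : R) (N : nat) :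
  0 <= y -> (1 + y) ^+ N * (1 - N%:R * y) <= 1.
Proof.
move=> y0; elim: N => [|N IH]; first by rewrite mul0r subr0 mulr1.
apply: le_trans IH; rewrite exprSr -mulrA ler_wpM2l ?exprn_ge0 ?addr_ge0 //.
by rewrite -natr1; have : 0 <= N%:R :> R by []; nra.
Qed.

(* If the residual misses T, then |T :&: S| <= e |M|, where M consists of the
   members of the packing which meet T.  So the indicator is at most
   2^(e |M|) (1/2)^|T :&: S|, one term of a sum over all packings, to which
   linearity of expectation applies. *)
Lemma residual_spread {R : realType} {X : finType} (H : {set {set X}})
    (e N : nat) (p : R) (T : {set X}) :
  (forall h, h \in H -> #|h| = e) ->
  (forall x, #|[set h in H | x \in h]%SET| <= N)%N ->
  0 <= p <= 1 -> N%:R * (4 * p) ^+ e <= p / 4 ->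
  \sum_(S : {set X}) bernoulli_weight p S * (residual H S \subset ~: T)%SET%:R
  <= (1 - p / 4) ^+ #|T|.
Proof.
move=> He HN p01 Np; have /andP[p0 p1] := p01.
(* The factor [1 - p * (1 - x)] at [x = 1/2]. *)
pose b : R := 1 - p / 2.
have b0 : 0 <= b by rewrite /b; lra.
have b1 : b <= 1 by rewrite /b; lra.
have q0 : 0 <= 1 - p / 4 by lra.
have b2 : 1 <= b * 2 by rewrite /b; lra.
pose good (D : {set {set X}}) := (D \subset meeting H T) && finset.trivIset D.
pose term (S : {set X}) (D : {set {set X}}) : R :=
  (2 ^+ e) ^+ #|D| * ((finset.cover D \subset S)%:R * 2^-1 ^+ #|T :&: S|%SET).
have term0 S D : 0 <= term S D.
  by rewrite mulr_ge0 ?exprn_ge0 // mulr_ge0 ?exprn_ge0.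
have step1 (S : {set X}) : (residual H S \subset ~: T)%SET%:R <=
    \sum_(D | good D) term S D.
  have [RT|_] := boolP (residual H S \subset _); last by apply: sumr_ge0.
  have /maxsetP[/and3P[DH Dtriv DS] _] := max_packingP H S.
  pose D := (max_packing H S :&: meeting H T)%SET.
  have gD : good D.
    rewrite /good finset.subsetIr /=; apply: trivIsetS Dtriv.
    exact: finset.subsetIl.
  rewrite (bigD1 D) //=; apply: (@le_trans _ _ (term S D)); last first.
    by rewrite lerDl; apply: sumr_ge0.
  have CS : finset.cover D \subset S.
    apply: fintype.subset_trans DS; apply/finset.bigcupsP => h; rewrite inE => /andP[hD _].
    exact: (finset.bigcup_sup h).
  have Hle h : h \in H -> (#|h| <= e)%N by move/He ->.
  have := card_residual_meeting H e S T Hle RT.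
  rewrite -/D => le; rewrite /term CS mul1r -exprM exprVn.
  by rewrite ler_pdivlMr ?exprn_gt0 // mul1r ler_weXn2l // ler1n.
(* The price of one packing member: [p ^+ e] for lying in [S], [2 ^+ e] from [term], and another
   [2 ^+ e] because up to [e] factors [b >= 1/2] are lost where the member covers [T]. *)
pose y : R := (4 * p) ^+ e.
have y0 : 0 <= y by rewrite exprn_ge0 // mulr_ge0.
have step2 D : good D -> \sum_(S : {set X}) bernoulli_weight p S * term S D
    <= b ^+ #|T| * y ^+ #|D|.
  move=> /andP[DM Dtriv].
  have cD : #|finset.cover D| = (e * #|D|)%N.
    apply: card_cover_trivIset Dtriv => h hD; apply: He.
    by move/(fintype.subsetP DM): hD => /bigcupP[x _]; rewrite inE => /andP[].
  under eq_bigr do rewrite /term mulrCA.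
  rewrite -mulr_sumr.
  have : \sum_(S : {set X}) bernoulli_weight p S *
      ((finset.cover D \subset S)%:R * 2^-1 ^+ #|T :&: S|%SET) <=
      p ^+ (e * #|D|) * b ^+ #|T :\: finset.cover D|%SET.
    rewrite -cD (_ : b = 1 - p * (1 - 2^-1)); last by rewrite /b; field.
    by apply: sum_bernoulli_subset_expr => //; apply/andP; split; lra.
  move=> /(ler_wpM2l (exprn_ge0 #|D| (exprn_ge0 e (ler0n R 2)))) /le_trans; apply.
  have bT : b ^+ #|T :\: finset.cover D|%SET <= b ^+ #|T| * 2 ^+ (e * #|D|).
    have cT : (#|T| <= #|T :\: finset.cover D|%SET + e * #|D|)%N.
      rewrite -cD -(finset.cardsID (finset.cover D) T) addnC leq_add2l.
      exact: subset_leq_card (finset.subsetIr _ _).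
    have le1 : b ^+ (#|T :\: finset.cover D|%SET + e * #|D|) <= b ^+ #|T|.
      by apply: ler_wiXn2l.
    have := ler_wpM2r (exprn_ge0 (e * #|D|) (ler0n R 2)) le1.
    apply: le_trans; rewrite exprD -mulrA -exprMn ler_peMr ?exprn_ge0 //.
    exact: exprn_ege1.
  rewrite (_ : y ^+ _ = (2 ^+ e) ^+ #|D| * (p ^+ (e * #|D|) * 2 ^+ (e * #|D|))).
    rewrite [leRHS]mulrCA ler_wpM2l ?exprn_ge0 //.
    by rewrite [leRHS]mulrCA ler_wpM2l ?exprn_ge0.
  by rewrite /y -!exprM -!exprMn; congr (_ ^+ _); ring.
apply: (@le_trans _ _ (\sum_(S : {set X}) bernoulli_weight p S *
    \sum_(D | good D) term S D)).
  by apply: ler_sum => S _; rewrite ler_wpM2l ?bernoulli_weight_ge0.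
under eq_bigr do rewrite mulr_sumr.
rewrite exchange_big /=.
apply: (@le_trans _ _ (\sum_(D | good D) b ^+ #|T| * y ^+ #|D|)).
  by apply: ler_sum => D; apply: step2.
apply: (@le_trans _ _ (b ^+ #|T| * (1 + y) ^+ #|meeting H T|)).
  rewrite -sum_subset_expr mulr_sumr [leRHS](bigID (fun D => finset.trivIset D)) /=.
  by rewrite lerDl; apply: sumr_ge0 => D _; apply: mulr_ge0; apply: exprn_ge0.
apply: (@le_trans _ _ (b ^+ #|T| * (1 + y) ^+ (N * #|T|))).
  by rewrite ler_wpM2l ?exprn_ge0 // ler_weXn2l ?lerDl // card_meeting.
have yN : 0 <= (1 + y) ^+ N by rewrite exprn_ge0 ?addr_ge0.
rewrite exprM -exprMn; apply: lerXn2r; rewrite ?nnegrE ?mulr_ge0 //.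
(* Since [N * y <= p / 4], the packings cost a factor of at most [1 / (1 - p / 4)] per element of
   [T]; this is affordable because [1 - p / 2 <= (1 - p / 4) ^+ 2]. *)
have bd : (1 + y) ^+ N * (1 - p / 4) <= 1.
  apply: le_trans (expr_bernoulli_bound y N y0).
  by rewrite ler_wpM2l // lerD2l lerN2.
have := ler_wpM2r q0 bd; rewrite mul1r; apply: le_trans.
rewrite -mulrA [leLHS]mulrC ler_wpM2l // /b.
have := sqr_ge0 (p / 4); set t := p / 4.
have -> : p / 2 = 2 * t by rewrite /t; field.
nra.
Qed.

(** The residual always lies in [A], so the covering inequality can be averaged over it. Then
    [lambda T] is weighted by the probability that the residual lies in [T], at most
    [(1 - p / 4) ^+ #|~: T|]. For [q < p / 4] the cost would therefore be at least 1. *)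
Lemma fractional_cover_ge {R : realType} {X : finType} (H A : {set {set X}})
    (e N : nat) (p q : R) (lambda : {set X} -> R) :
  (forall h, h \in H -> #|h| = e) -> (0 < e)%N ->
  (forall x, #|[set h in H | x \in h]%SET| <= N)%N ->
  (forall S : {set X}, (forall h, h \in H -> ~~ (h \subset S)) -> S \in A) ->
  0 <= p <= 1 -> N%:R * (4 * p) ^+ e <= p / 4 ->
  (forall S, 0 <= lambda S) ->
  \sum_(S : {set X}) lambda S * (1 - q) ^+ #|~: S|%SET <= 1 / 2 ->
  (forall S : {set X}, S \in A -> 1 <= \sum_(T : {set X} | S \subset T) lambda T) ->
  p / 4 <= q.
Proof.
move=> He e0 HN HA p01 Np l0 cost cov; have /andP[p0 p1] := p01.
rewrite leNgt; apply/negP => qp.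
suff : 1 <= \sum_(S : {set X}) lambda S * (1 - q) ^+ #|~: S|%SET by lra.
apply: (@le_trans _ _ (\sum_(S : {set X}) lambda S * (1 - p / 4) ^+ #|~: S|%SET)).
  rewrite -[leLHS](sum_bernoulli (X := X) p).
  apply: (@le_trans _ _ (\sum_(S : {set X}) bernoulli_weight p S *
      \sum_(T : {set X} | residual H S \subset T) lambda T)).
    apply: ler_sum => S _; rewrite ler_peMr ?bernoulli_weight_ge0 //.
    apply: cov; apply: HA => h hH; apply: residual_avoids => //.
    by rewrite (He h).
  under eq_bigr => S _ do rewrite big_mkcond mulr_sumr /=.
  rewrite exchange_big /=; apply: ler_sum => T _.
  have := residual_spread H e N p (~: T)%SET He HN p01 Np.
  move=> /(ler_wpM2l (l0 T)); apply: le_trans.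
  rewrite finset.setCK mulr_sumr; apply: ler_sum => S _.
  by case: ifP => _; rewrite ?mulr0 // mulr1 mulrC.
apply: ler_sum => S _; rewrite ler_wpM2l // lerXn2r ?nnegrE //; lra.
Qed.

(** * Attainment of the expectation thresholds *)

(* L is the set of admissible weights: [0, 1] suffices for the fractional
   threshold, and {0, 1} gives the integral one. *)
Definition weighted_cover_range {R : realType} {X : finType} (L : set R)
    (A : {set {set X}}) : set R :=
  [set p : R | 0 <= p <= 1 /\
    exists lambda : {set X} -> R,
      [/\ forall S, L (lambda S),
          \sum_(S : {set X}) lambda S * (1 - p) ^+ #|(~: S)%SET| <= 1 / 2
        & forall S : {set X}, S \in A ->
            1 <= \sum_(T : {set X} | S \subset T) lambda T]].

Lemma continuous_bigsum {R : realType} {T : topologicalType} {I : Type}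
    (r : seq I) (P : pred I) (f : I -> T -> R) :
  (forall i, continuous (f i)) ->
  continuous (fun x => \sum_(i <- r | P i) f i x).
Proof.
move=> cf; elim: r => [|i r IH] x.
  by under eq_fun do rewrite big_nil; apply: cst_continuous.
under eq_fun do rewrite big_cons.
by case: (P i); [apply: cvgD; [exact: cf|exact: IH]|exact: IH].
Qed.

Lemma closed_sublevel {R : realType} {T : topologicalType} (f : T -> R) (a : R) :
  continuous f -> closed [set x | f x <= a].
Proof.
move=> cf; apply: (@closed_comp _ _ f [set x | x <= a]); last exact: closed_le.
by move=> x _; apply: cf.
Qed.

(** The pairs of [p] and [lambda] form a compact set of row vectors, cut out of a box by finitely
    many continuous inequalities, and the coordinate [p] attains its minimum there. Slot 0 holds
    [p], the other slots hold the weights. *)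
Lemma weighted_cover_range_min {R : realType} {X : finType} (L : set R)
    (A : {set {set X}}) : compact L -> L 0 -> L 1 -> [set: X]%SET \notin A ->
  exists p, weighted_cover_range L A p /\ lbound (weighted_cover_range L A) p.
Proof.
move=> Lc L0 L1 XA.
pose n := #|{: {set X}}|.
pose idx (S : {set X}) : 'I_n.+1 := lift ord0 (enum_rank S).
pose box (i : 'I_n.+1) : set R := if i == ord0 then [set` `[0, 1]] else L.
pose cost (v : 'rV[R]_n.+1) :=
  \sum_(S : {set X}) v ord0 (idx S) * (1 - v ord0 ord0) ^+ #|(~: S)%SET|.
pose load (S : {set X}) (v : 'rV[R]_n.+1) :=
  \sum_(T : {set X} | S \subset T) v ord0 (idx T).
pose K := [set v : 'rV[R]_n.+1 | forall i, box i (v ord0 i)] `&`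
  ([set v | cost v <= 1 / 2] `&`
   \bigcap_(S in [set S : {set X} | S \in A]) [set v | - load S v <= - 1]).
pose vec p (lambda : {set X} -> R) : 'rV[R]_n.+1 :=
  \row_i (if unlift ord0 i is Some j then lambda (enum_val j) else p).
have vec0 p lambda : vec p lambda ord0 ord0 = p by rewrite mxE unlift_none.
have vecS p lambda S : vec p lambda ord0 (idx S) = lambda S.
  by rewrite mxE liftK enum_rankK.
have cK v : K v -> weighted_cover_range L A (v ord0 ord0).
  move=> [vbox [vcost vload]]; split.
    by have := vbox ord0; rewrite /box eqxx /= in_itv.
  exists (fun S => v ord0 (idx S)); split=> [S||S SA].
  - by have := vbox (idx S); rewrite /box.
  - exact: vcost.
  - by have := vload S SA; rewrite /= lerN2.
have Kc p : weighted_cover_range L A p -> exists2 v, K v & v ord0 ord0 = p.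
  move=> [p01 [lambda [lL lcost lcov]]]; exists (vec p lambda) => //; split.
    move=> i /=; rewrite /box mxE; case: unliftP => [j ->|->].
      by rewrite eq_sym (negbTE (neq_lift _ _)).
    by rewrite eqxx /= in_itv.
  split=> [|S SA] /=.
    by rewrite /cost; under eq_bigr do rewrite vec0 vecS.
  by rewrite lerN2 /load; under eq_bigr do rewrite vecS; apply: lcov.
have coord i : continuous (fun v : 'rV[R]_n.+1 => v ord0 i).
  exact: coord_continuous.
have K_compact : compact K.
  apply: compact_closedI.
    apply: rV_compact => i; rewrite /box; case: ifP => // _.
    exact: segment_compact.
  apply: closedI.
    apply: closed_sublevel; apply: continuous_bigsum => S v.
    apply: (@continuousM _ _ (fun v : 'rV[R]_n.+1 => v ord0 (idx S))
      (fun v : 'rV[R]_n.+1 => (1 - v ord0 ord0) ^+ #|(~: S)%SET|));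
      first exact: coord.
    apply: (@continuous_comp _ _ _ (fun v : 'rV[R]_n.+1 => 1 - v ord0 ord0)
      (fun x : R => x ^+ #|(~: S)%SET|)); last exact: exprn_continuous.
    apply: (@continuousB R R^o _ (fun _ : 'rV[R]_n.+1 => 1)
      (fun v : 'rV[R]_n.+1 => v ord0 ord0)).
      exact: cst_continuous.
    exact: coord.
  apply: closed_bigI => S _; apply: closed_sublevel => v.
  apply: (@continuousN R R^o _ (load S)).
  by apply: continuous_bigsum => T; apply: coord.
have [v Kv vmin] : exists2 v, v \in K & forall w, w \in K ->
    v ord0 ord0 <= w ord0 ord0.
  apply: (@compact_EVT_min _ _ (fun v : 'rV[R]_n.+1 => v ord0 ord0) K) => //;
    last by apply: continuous_subspaceT; apply: coord.
  suff [v Kv _] : exists2 v, K v & v ord0 ord0 = 1 by exists v.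
  apply: Kc; split; first by rewrite ler01 lexx.
  (* Non-emptiness at [p = 1]: every set covers itself, and as [0 ^+ 0 = 1] only the full set has a
     cost, which is not in [A]. *)
  exists (fun S => (S \in A)%:R); split=> [S||S SA].
  - by case: (S \in A).
  - rewrite big1 ?divr_ge0 // => S _; rewrite subrr expr0n cards_eq0.
    have [E|_] := eqVneq (~: S)%SET finset.set0; last by rewrite mulr0.
    by rewrite -(finset.setCK S) E finset.setC0 (negbTE XA) mul0r.
  - by rewrite (bigD1 S) //= SA lerDl sumr_ge0.
exists (v ord0 ord0); split; first by apply: cK; apply: set_mem.
by move=> p /Kc[w Kw <-]; apply: vmin; apply: mem_set.
Qed.

Lemma smallest_ofP {R : realType} (B : set R) :
  (exists p, B p /\ lbound B p) -> B (smallest_of B).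
Proof. by move=> /(xgetPex 0)[]. Qed.

(** Compactness needs bounded weights, so weights are truncated at 1. The cover survives: either one
    superset of [S] already has weight at least 1, or no weight above [S] changes. *)
Lemma fractional_expectation_thresholdP {R : realType} {X : finType}
    (A : {set {set X}}) : [set: X]%SET \notin A ->
  weighted_cover_range [set x : R | 0 <= x] A (fractional_expectation_threshold R A).
Proof.
move=> XA.
rewrite (_ : fractional_expectation_threshold R A =
  smallest_of (weighted_cover_range [set x : R | 0 <= x] A)); last by [].
apply: smallest_ofP.
rewrite (_ : weighted_cover_range _ A = weighted_cover_range `[0, 1] A).
  apply: weighted_cover_range_min => //; first exact: segment_compact.
    by rewrite /= in_itv /= lexx ler01.
  by rewrite /= in_itv /= lexx ler01.
apply/seteqP; split=> p [p01 [lambda [l0 lcost lcov]]]; split=> //; last first.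
  by exists lambda; split=> // S; have := l0 S; rewrite /= in_itv => /andP[].
have /andP[p0 p1] := p01.
exists (fun S => Num.min (lambda S) 1); split=> [S||S SA].
- by rewrite /= in_itv /= le_min ler01 (l0 S) ge_min lexx orbT.
- apply: le_trans lcost; apply: ler_sum => S _; apply: ler_wpM2r.
    by rewrite exprn_ge0 // subr_ge0.
  by rewrite ge_min lexx.
have m0 T : 0 <= Num.min (lambda T) 1 by rewrite le_min ler01 (l0 T).
have [/existsP[T /andP[ST lT]]|no] :=
    boolP [exists T : {set X}, (S \subset T) && (1 <= lambda T)].
  by rewrite (bigD1 T) //= (min_idPr lT) lerDl sumr_ge0.
apply: le_trans (lcov S SA) _; apply: ler_sum => T ST.
rewrite le_min lexx /=; move/existsPn: no => /(_ T).
by rewrite ST /= -ltNge => /ltW.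
Qed.

(** A family [G] is the same as a weight with values in the compact set of 0 and 1; a sum of such
    weights is at least 1 exactly when some superset belongs to [G]. *)
Lemma expectation_thresholdP {R : realType} {X : finType}
    (A : {set {set X}}) : [set: X]%SET \notin A ->
  weighted_cover_range [set x : R | 0 <= x] A (expectation_threshold R A).
Proof.
move=> XA; pose L := [set (0 : R)] `|` [set (1 : R)].
suff : weighted_cover_range L A (expectation_threshold R A).
  move=> [p01 [lambda [lL lcost lcov]]]; split=> //; exists lambda; split=> // S.
  by case: (lL S) => /= ->.
have costE (G : {set {set X}}) (p : R) :
    \sum_(S in G) (1 - p) ^+ #|(~: S)%SET| =
    \sum_(S : {set X}) (S \in G)%:R * (1 - p) ^+ #|(~: S)%SET|.
  by rewrite big_mkcond; apply: eq_bigr => S _; case: ifP; rewrite ?mul1r ?mul0r.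
rewrite (_ : expectation_threshold R A = smallest_of (weighted_cover_range L A)).
  apply: smallest_ofP; apply: weighted_cover_range_min => //.
  - by apply: compactU; apply: compact_set1.
  - by left.
  - by right.
congr smallest_of; apply/seteqP; split=> p [p01].
  move=> [G [Gcost AG]]; split=> //; exists (fun S => (S \in G)%:R); split.
  - by move=> S; case: (S \in G); [right|left].
  - by rewrite -costE.
  move=> S /(fintype.subsetP AG)/finset.bigcupP[T TG]; rewrite powersetE => ST.
  by rewrite (bigD1 T) //= TG lerDl sumr_ge0.
move=> [lambda [lL lcost lcov]]; split=> //; exists [set S | lambda S == 1]%SET.
have lE S : lambda S = (S \in [set S | lambda S == 1]%SET)%:R.
  by rewrite inE; case: (lL S) => /= ->; rewrite ?eqxx // eq_sym oner_eq0.
split; first by rewrite costE; under eq_bigr do rewrite -lE.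
apply/fintype.subsetP => S SA; apply/finset.bigcupP; apply: contrapT => no.
have := lcov S SA; rewrite big1 ?ler10 // => T ST; rewrite lE.
case: (boolP (T \in _)) => // TG; case: no; exists T => //.
by rewrite powersetE.
Qed.

(** * Copies of a graph *)

(** Meaningful for every [f]: an edge whose ends are identified has an image of size 1 and simply
    disappears. *)
Definition copy {V W : finType} (f : V -> W) (E : graph V) : graph W :=
  [set x : edge W | val x \in [set f @: val e | e : edge V in E]]%SET.

Lemma copyP {V W : finType} (f : V -> W) (E : graph V) (x : edge W) :
  reflect (exists2 e : edge V, e \in E & val x = (f @: val e)%SET)
    (x \in copy f E).
Proof. by rewrite inE; apply: imsetP. Qed.

Lemma copyS {V W : finType} (f : V -> W) (E E' : graph V) :
  E \subset E' -> copy f E \subset copy f E'.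
Proof.
move=> /fintype.subsetP EE'; apply/fintype.subsetP => x /copyP[e eE xe].
by apply/copyP; exists e => //; apply: EE'.
Qed.

Lemma val_copy {V W : finType} (f : V -> W) (E : graph V) : injective f ->
  [set val x | x : edge W in copy f E]%SET = [set f @: val e | e : edge V in E]%SET.
Proof.
move=> finj; apply/setP => y; apply/imsetP/imsetP => [[x /copyP[e eE xe] ->]|].
  by exists e.
move=> [e eE ->].
have c2 : #|(f @: val e)%SET| == 2%N by rewrite card_imset // (valP e).
exists (exist _ (f @: val e)%SET c2) => //; apply/copyP; by exists e.
Qed.

Lemma card_copy {V W : finType} (f : V -> W) (E : graph V) : injective f ->
  #|copy f E| = #|E|.
Proof.
move=> finj; rewrite -(card_imset (mem (copy f E)) val_inj) val_copy //.
apply: card_imset => e e' /(imset_inj finj); exact: val_inj.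
Qed.

Lemma eq_in_copy {V W : finType} (f g : V -> W) (A : {set V}) (E : graph V) :
  [forall e in E, val e \subset A] -> {in A, f =1 g} -> copy f E = copy g E.
Proof.
move=> /forall_inP EA fg; apply/setP => x; apply/copyP/copyP => -[e eE ->];
  exists e => //; apply: eq_in_imset => v ve; rewrite fg //;
  exact: (fintype.subsetP (EA e eE)).
Qed.

Lemma F_freeP {V W : finType} (F : graph V) (G : graph W) :
  reflect (forall f : {ffun V -> W}, injective f -> ~~ (copy f F \subset G))
    (F_free F G).
Proof.
apply: (iffP idP) => [free f finj|no].
  apply: contra free => FG; apply/existsP.
  exists ((f @: [set: V])%SET, copy f F).
  rewrite /subgraph /isomorphic /= FG /=; apply/andP; split.
    apply/forall_inP => x /copyP[e _ ->]; apply: imsetS; exact: finset.subsetT.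
  apply/existsP; exists f; rewrite eqxx /= val_copy // eqxx andbT.
  exact/injectiveP.
apply/negP => /existsP[[J1 J2] /andP[/andP[/= JG _]]].
move=> /existsP[f /and3P[/injectiveP finj _ /eqP/= FJ]].
move/negP: (no f finj); apply; apply/fintype.subsetP => x.
rewrite inE FJ => /imsetP[y yJ /val_inj ->]; exact: (fintype.subsetP JG).
Qed.

Lemma set0_free_family {V : finType} (F : graph V) (n : nat) :
  (0 < #|F|)%N -> finset.set0 \in free_family F n.
Proof.
move=> F0; rewrite inE; apply/F_freeP => f finj.
by rewrite finset.subset0 -cards_eq0 card_copy // -lt0n.
Qed.

Lemma setT_free_family {V : finType} (F : graph V) (n : nat) :
  (#|V| <= n)%N -> [set: edge 'I_n]%SET \notin free_family F n.
Proof.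
move=> Vn; pose f : {ffun V -> 'I_n} := [ffun v => widen_ord Vn (enum_rank v)].
have finj : injective f.
  by move=> v w; rewrite !ffunE => /(congr1 val)/= /val_inj/enum_rank_inj.
by rewrite inE; apply/negP => /F_freeP /(_ f finj); rewrite finset.subsetT.
Qed.

Lemma card_family_prod {V W : finType} (Q : V -> {set W}) :
  #|family (fun v => mem (Q v))| = (\prod_v #|Q v|)%N.
Proof.
rewrite card_family foldrE big_image /=.
by apply: eq_bigr.
Qed.

(** A copy depends only on the values of [f] on [A]. Fixing all other values to those of one
    reference map [f0] leaves only the choices on [A] to count. *)
Lemma card_copies {V W : finType} (A : {set V}) (E : graph V) (Q : V -> {set W}) :
  [forall e in E, val e \subset A] ->
  (#|[set copy (f : {ffun V -> W}) E | f : {ffun V -> W} &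
       [forall v in A, f v \in Q v]]%SET| <= \prod_(v in A) #|Q v|)%N.
Proof.
move=> EA; set C := finset.imset _ _.
have [/eqP ->|] := boolP (C == finset.set0); first by rewrite cards0.
case/set0Pn => x0 /imsetP[f0 _ _].
pose Q' v : {set W} := if v \in A then Q v else [set f0 v]%SET.
apply: (@leq_trans #|family (fun v => mem (Q' v))|); last first.
  rewrite card_family_prod [X in (_ <= X)%N]big_mkcond /=; apply: leq_prod => v _.
  by rewrite /Q'; case: ifP; rewrite ?cards1.
apply: (@leq_trans #|[set copy (f : {ffun V -> W}) E | f in
    family (fun v => mem (Q' v))]%SET|); last exact: leq_imset_card.
apply: subset_leq_card; apply/fintype.subsetP => x /imsetP[f].
rewrite inE => /forall_inP fQ ->; apply/imsetP.
exists [ffun v => if v \in A then f v else f0 v].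
  apply/familyP => v; rewrite ffunE /Q'; case: (boolP (v \in A)) => vA.
    exact: fQ.
  by rewrite set11.
by apply: (eq_in_copy _ _ A E EA) => v vA; rewrite ffunE vA.
Qed.

(** * Densities and the expectation thresholds *)

Lemma bigmax_attained {R : realType} {I : finType} (P : pred I) (f : I -> R) :
  0 < \big[Num.max/0]_(i | P i) f i ->
  exists2 i, P i & \big[Num.max/0]_(i | P i) f i = f i.
Proof.
set M := \big[_/_]_(_ | _) _ => M0.
suff [E|//] : M = 0 \/ exists2 i, P i & M = f i by rewrite E ltxx in M0.
rewrite /M; apply: (big_ind (fun x => x = 0 \/ exists2 i, P i & x = f i)).
- by left.
- by move=> x y Kx Ky; case: (leP x y) => _.
- by move=> i Pi; right; exists i.
Qed.

Lemma max_degree_ge2 {V : finType} (F : graph V) : (2 <= max_degree F)%N ->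
  (2 <= #|F|)%N /\ (3 <= #|V|)%N.
Proof.
move=> deg; have F2 : (2 <= #|F|)%N.
  apply: leq_trans deg _; apply/bigmax_leqP => v _; apply: subset_leq_card.
  by apply/fintype.subsetP => e; rewrite inE => /andP[].
split=> //; have /card_gt1P[e [e' [_ _ ee']]] := F2.
rewrite ltnNge; apply: contra ee' => V2; apply/eqP/val_inj.
have full (x : edge V) : val x = [set: V]%SET.
  by apply/eqP; rewrite eqEcard finset.subsetT cardsT (eqP (valP x)).
by rewrite !full.
Qed.

Lemma subgraphT {V : finType} (F : graph V) : subgraph F ([set: V]%SET, F).
Proof.
by rewrite /subgraph /= fintype.subxx; apply/forall_inP => e _; apply: finset.subsetT.
Qed.

Lemma density_m_attained (R : realType) {V : finType} (F : graph V) :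
  (0 < #|F|)%N -> (0 < #|V|)%N -> 0 < density_m R F /\
  exists J, [/\ subgraph F J, (0 < #|J.1|)%N, (0 < #|J.2|)%N
    & #|J.2|%:R = density_m R F * #|J.1|%:R].
Proof.
move=> F0 V0.
have m0 : 0 < density_m R F.
  apply: lt_le_trans (_ : (#|F|%:R / #|[set: V]%SET|%:R) <= _).
    by rewrite divr_gt0 ?ltr0n // cardsT.
  apply: (@le_bigmax_cond _ R _ 0 ([set: V]%SET, F) _
    (fun J : {set V} * graph V => #|J.2|%:R / #|J.1|%:R)).
  by rewrite subgraphT /= cardsT.
split=> //; have [J /andP[FJ J1] E] := bigmax_attained _ _ m0.
have J10 : 0 < #|J.1|%:R :> R by rewrite ltr0n.
exists J; rewrite FJ J1; split=> //; last first.
  by rewrite /density_m E divfK ?gt_eqF.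
by move: m0; rewrite /density_m E pmulr_lgt0 ?invr_gt0 // ltr0n.
Qed.

Lemma density_m_ge (R : realType) {V : finType} (F : graph V)
    (J : {set V} * graph V) :
  subgraph F J -> (0 < #|J.1|)%N -> #|J.2|%:R <= density_m R F * #|J.1|%:R.
Proof.
move=> FJ J0; rewrite -ler_pdivrMr ?ltr0n //.
apply: (@le_bigmax_cond _ R _ 0 J _
  (fun J : {set V} * graph V => #|J.2|%:R / #|J.1|%:R)).
by rewrite FJ.
Qed.

Lemma density_m2_attained (R : realType) {V : finType} (F : graph V) :
  (2 <= #|F|)%N -> (3 <= #|V|)%N -> 0 < density_m2 R F /\
  exists J, [/\ subgraph F J, (3 <= #|J.1|)%N, (2 <= #|J.2|)%N
    & #|J.2|.-1%:R = density_m2 R F * (#|J.1| - 2)%:R].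
Proof.
move=> F2 V3.
have pos k : (3 <= k)%N -> 0 < k%:R - 2 :> R.
  by move=> k3; rewrite subr_gt0 ltr_nat.
have m0 : 0 < density_m2 R F.
  apply: lt_le_trans (_ : ((#|F|%:R - 1) / (#|[set: V]%SET|%:R - 2)) <= _).
    by rewrite divr_gt0 ?pos ?cardsT // subr_gt0 ltr1n.
  apply: (@le_bigmax_cond _ R _ 0 ([set: V]%SET, F) _
    (fun J : {set V} * graph V => (#|J.2|%:R - 1) / (#|J.1|%:R - 2))).
  by rewrite subgraphT /= cardsT.
split=> //; have [J /andP[FJ J1] E] := bigmax_attained _ _ m0.
have J2 : (2 <= #|J.2|)%N.
  by move: m0; rewrite /density_m2 E pmulr_lgt0 ?invr_gt0 ?pos // subr_gt0 ltr1n.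
exists J; split=> //.
rewrite /density_m2 E natrB ?(ltnW J1) // divfK ?gt_eqF ?pos //.
by rewrite -subn1 natrB // ltnW.
Qed.

(** At edge probability [n ^ (-1/m)] a densest subgraph has about one expected copy ([k = e_J],
    [l = v_J]), respectively one per given edge ([k = e_J - 1], [l = v_J - 2]). *)
Lemma powR_density {R : realType} (m : R) (n k l : nat) :
  0 < m -> (0 < n)%N -> k%:R = m * l%:R ->
  (n%:R `^ (- 1 / m)) ^+ k * n%:R ^+ l = 1.
Proof.
move=> m0 n0 kl; have nn : n%:R != 0 :> R by rewrite pnatr_eq0 -lt0n.
rewrite -powR_mulrn ?powR_ge0 // -powRrM kl.
rewrite (_ : - 1 / m * (m * l%:R) = - l%:R); last by field; rewrite gt_eqF.
by rewrite powRN powR_mulrn // mulVf ?expf_neq0.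
Qed.

Lemma powR_density_bound {R : realType} (m : R) (n : nat) :
  0 < m -> (0 < n)%N -> 0 < n%:R `^ (- 1 / m) <= 1.
Proof.
move=> m0 n0; rewrite powR_gt0 ?ltr0n //= mulN1r powRN invf_le1 ?powR_gt0 ?ltr0n //.
by rewrite -[leLHS](powRr0 n%:R) ler_powR ?ler1n // invr_ge0 ltW.
Qed.

(** Some edge [e] of [J] is sent onto [x]; its two ends have at most 2 images each, and every other
    vertex of [J] at most [n]. *)
Lemma card_copies_through {V : finType} (J : {set V} * graph V) (n : nat)
    (x : edge 'I_n) : [forall e in J.2, val e \subset J.1] ->
  (#|[set h in [set copy (f : {ffun V -> 'I_n}) J.2 | f : {ffun V -> 'I_n}] |
       x \in h]%SET| <= #|J.2| * (4 * n ^ (#|J.1| - 2)))%N.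
Proof.
move=> JE; pose Q (e : edge V) v := if v \in val e then val x else [set: 'I_n]%SET.
pose C e := [set copy (f : {ffun V -> 'I_n}) J.2 | f : {ffun V -> 'I_n} &
  [forall v in J.1, f v \in Q e v]]%SET.
have CQ e : e \in J.2 -> (#|C e| <= 4 * n ^ (#|J.1| - 2))%N.
  move=> eJ; have eJ1 := forall_inP JE e eJ.
  apply: leq_trans (card_copies _ _ _ JE) _.
  rewrite (bigID (mem (val e))) /= leq_mul //.
    rewrite (eq_bigr (fun=> 2%N)); last first.
      by move=> v /andP[_ ve]; rewrite /Q ve (eqP (valP x)).
    rewrite (eq_bigl (mem (val e))); last first.
      by move=> v /=; rewrite andb_idl //; apply/fintype.subsetP.
    by rewrite prod_nat_const (eqP (valP e)).
  rewrite (eq_bigr (fun=> n)); last first.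
    by move=> v /andP[_ ve]; rewrite /Q (negbTE ve) cardsT card_ord.
  rewrite (eq_bigl (mem (J.1 :\: val e)%SET)); last first.
    by move=> v; rewrite !inE andbC.
  by rewrite prod_nat_const cardsD (finset.setIidPr eJ1) (eqP (valP e)).
apply: (@leq_trans #|(\bigcup_(e in J.2) C e)%SET|).
  apply: subset_leq_card; apply/fintype.subsetP => h.
  rewrite inE => /andP[/imsetP[f _ ->] /copyP[e eJ xe]].
  apply/finset.bigcupP; exists e => //; apply/imsetP; exists f => //.
  rewrite inE; apply/forall_inP => v _; rewrite /Q; case: ifP => ve; last by rewrite inE.
  by rewrite xe imset_f.
apply: (@leq_trans (\sum_(e in J.2) #|C e|)%N).
  apply: (big_ind2 (fun (A : {set graph 'I_n}) k => (#|A| <= k)%N)) => //.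
    by rewrite cards0.
  by move=> A k B l Ak Bl; apply: leq_trans (leq_card_setU _ _) (leq_add Ak Bl).
by rewrite -sum_nat_const; apply: leq_sum.
Qed.

Lemma weighted_cover_free_family_ge {R : realType} {V : finType} (F : graph V) :
  (2 <= max_degree F)%N -> exists2 c : R, 0 < c & forall (n : nat) (q : R),
    (0 < n)%N -> weighted_cover_range [set x | 0 <= x] (free_family F n) q ->
    c * n%:R `^ (- 1 / density_m2 R F) <= q.
Proof.
move=> /max_degree_ge2[F2 V3].
have [m0 [J [/andP[JF JE] J3 J2 mE]]] := density_m2_attained R F F2 V3.
set m := density_m2 R F in m0 mE *; set e := #|J.2| in J2 mE.
have ee : e = e.-1.+1 by rewrite prednK // ltnW.
(* Chosen so that [N * (4 * p) ^+ e] equals [p / 4] times [b * p ^+ (e - 1) * n ^+ (v_J - 2)]. *)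
pose b : R := 16 * e%:R * 4 ^+ e.
have b1 : 1 <= b.
  apply: mulr_ege1; last by rewrite exprn_ege1 // ler1n.
  by apply: mulr_ege1; rewrite ler1n // ltnW.
have b0 : 0 < b by apply: lt_le_trans b1.
exists (b^-1 / 4); first by rewrite divr_gt0 ?invr_gt0.
move=> n q n0 [q01 [lambda [l0 cost cov]]].
have /andP[d0 d1] := powR_density_bound m n m0 n0.
set d := n%:R `^ (- 1 / m) in d0 d1 *.
rewrite mulrAC; pose p := b^-1 * d; rewrite -/p.
have p0 : 0 <= p by rewrite mulr_ge0 ?invr_ge0 // ltW.
have p1 : p <= 1 by rewrite mulr_ile1 ?invr_ge0 ?invf_le1 // ltW.
pose H := [set copy (f : {ffun V -> 'I_n}) J.2 | f : {ffun V -> 'I_n}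
  & injectiveb f]%SET.
pose N := (e * (4 * n ^ (#|J.1| - 2)))%N.
apply: (fractional_cover_ge H (free_family F n) e N p q lambda) => //.
- by move=> h /imsetP[f]; rewrite inE => /injectiveP finj ->; rewrite card_copy.
- by rewrite ltnW.
- move=> x; apply: leq_trans (card_copies_through J n x JE).
  apply: subset_leq_card; apply/fintype.subsetP => h; rewrite !inE.
  move=> /andP[/imsetP[f _ ->] ->]; rewrite andbT; exact: imset_f.
- move=> S HS; rewrite inE; apply/F_freeP => f finj.
  have /HS : copy f J.2 \in H by apply: imset_f; rewrite inE; apply/injectiveP.
  by apply: contra; apply: fintype.subset_trans (copyS _ _ _ JF).
- by rewrite p0 p1.
have dn := powR_density m n _ _ m0 n0 mE; rewrite -/d in dn.
have -> : N%:R * (4 * p) ^+ e =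
    (p / 4) * (b * (p ^+ e.-1 * n%:R ^+ (#|J.1| - 2))).
  rewrite /N !natrM natrX exprMn [in p ^+ e]ee [p ^+ _]exprSr /b.
  move: (4 ^+ e) (p ^+ e.-1) (n%:R ^+ (#|J.1| - 2)) (e%:R) => u w t r.
  by field.
rewrite ler_piMr ?divr_ge0 // /p exprMn -[_ * d ^+ _ * _]mulrA dn mulr1.
(* What remains is [b * b^-1 ^+ (e - 1)]. As [e >= 2], one inverse cancels [b] and the others are at
   most 1. *)
have -> : e.-1 = e.-2.+1 by rewrite prednK // -ltnS -ee.
rewrite exprS mulrA mulfV ?gt_eqF // mul1r.
by apply: exprn_ile1; rewrite ?invr_ge0 ?invf_le1 // ltW.
Qed.

(** * The threshold *)

Lemma muE {R : realType} {X : finType} (p : R) (A : {set {set X}}) :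
  mu p A = \sum_(S : {set X}) bernoulli_weight p S * (S \in A)%:R.
Proof.
rewrite /mu big_mkcond; apply: eq_bigr => S _.
by case: (S \in A); rewrite ?mulr1 ?mulr0.
Qed.

Lemma continuous_mu {R : realType} {X : finType} (A : {set {set X}}) :
  continuous (fun p : R => mu p A).
Proof.
apply: continuous_bigsum => S p.
apply: (@continuousM _ _ (fun p : R => p ^+ #|S|)
  (fun p : R => (1 - p) ^+ #|(~: S)%SET|)); first exact: exprn_continuous.
apply: (@continuous_comp _ _ _ (fun p : R => 1 - p)
  (fun x : R => x ^+ #|(~: S)%SET|)); last exact: exprn_continuous.
apply: (@continuousB R R^o _ (fun _ : R => 1) (fun p : R => p)).
  exact: cst_continuous.
exact: cvg_id.
Qed.

(** Intermediate value theorem: all mass sits on the empty set at [p = 0] and on the full set at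
    [p = 1]. *)
Lemma thresholdP {R : realType} {X : finType} (A : {set {set X}}) :
  finset.set0 \in A -> [set: X]%SET \notin A ->
  0 <= threshold R A <= 1 /\ mu (threshold R A) A = 1 / 2.
Proof.
move=> A0 AT; apply: (@xgetPex _ 0 [set p : R | 0 <= p <= 1 /\ mu p A = 1 / 2]).
have mu0 : mu (0 : R) A = 1.
  rewrite /mu (bigD1 finset.set0) //= cards0 subr0 expr0 expr1n mulr1.
  rewrite big1 ?addr0 // => S /andP[_ S0].
  by rewrite expr0n cards_eq0 (negbTE S0) mul0r.
have mu1 : mu (1 : R) A = 0.
  rewrite /mu big1 // => S SA; rewrite subrr [X in _ * X]expr0n cards_eq0.
  have [E|_] := eqVneq (~: S)%SET finset.set0; last by rewrite mulr0.
  by move: SA; rewrite -(finset.setCK S) E finset.setC0 (negbTE AT).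
have [|||p] := @IVT R (fun p => mu p A) 0 1 (1 / 2).
- exact: ler01.
- by apply: continuous_subspaceT; apply: continuous_mu.
- rewrite mu0 mu1 (min_idPr ler01) (max_idPl ler01); apply/andP; split; lra.
- by rewrite in_itv /= => p01 mup; exists p.
Qed.

(** Union bound: a set outside [A] contains a member of [H], so the indicator of [A] plus the number
    of contained members is at least 1. *)
Lemma mu_avoid_ge {R : realType} {X : finType} (H A : {set {set X}}) (e : nat)
    (p : R) : 0 <= p <= 1 -> (forall h, h \in H -> #|h| = e) ->
  (forall S : {set X}, (forall h, h \in H -> ~~ (h \subset S)) -> S \in A) ->
  1 - #|H|%:R * p ^+ e <= mu p A.
Proof.
move=> p01 He HA; rewrite lerBlDr -[leLHS](sum_bernoulli (X := X) p) muE.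
have -> : #|H|%:R * p ^+ e =
    \sum_(S : {set X}) bernoulli_weight p S * \sum_(h in H) (h \subset S)%:R.
  under [RHS]eq_bigr do rewrite mulr_sumr.
  rewrite exchange_big /= mulr_natl -sumr_const; apply: eq_bigr => h hH.
  by rewrite sum_bernoulli_subset He.
rewrite -big_split /=; apply: ler_sum => S _; rewrite -mulrDr.
rewrite ler_peMr ?bernoulli_weight_ge0 //.
have [SA|SA] := boolP (S \in A); first by rewrite lerDl sumr_ge0.
have [/existsP[h /andP[hH hS]]|no] := boolP [exists h, (h \in H) && (h \subset S)].
  by rewrite add0r (bigD1 h) //= hS lerDl sumr_ge0.
case/negP: SA; apply: HA => h hH.
by move/existsPn: no => /(_ h); rewrite hH.
Qed.

Lemma threshold_free_family_ge {R : realType} {V : finType} (F : graph V)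
    (n : nat) (p : R) : (0 < #|F|)%N -> (0 < #|V|)%N -> (0 < n)%N ->
  0 <= p <= 1 -> mu p (free_family F n) = 1 / 2 ->
  1 / 2 * n%:R `^ (- 1 / density_m R F) <= p.
Proof.
move=> F0 V0 n0 p01 mup; have /andP[p0 p1] := p01.
have [m0 [J [/andP[JF JE] J1 J2 mE]]] := density_m_attained R F F0 V0.
set m := density_m R F in m0 mE *.
have /andP[d0 d1] := powR_density_bound m n m0 n0.
have dn := powR_density m n _ _ m0 n0 mE.
set d := n%:R `^ (- 1 / m) in d0 d1 dn *.
pose H := [set copy (f : {ffun V -> 'I_n}) J.2 | f : {ffun V -> 'I_n}
  & injectiveb f]%SET.
have HN : (#|H| <= n ^ #|J.1|)%N.
  have := card_copies J.1 J.2 (fun=> [set: 'I_n]%SET) JE.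
  rewrite prod_nat_const cardsT card_ord; apply: leq_trans.
  apply: subset_leq_card; apply/fintype.subsetP => h /imsetP[f _ ->].
  by apply: imset_f; rewrite inE; apply/forall_inP => v _; rewrite inE.
have : 1 - #|H|%:R * p ^+ #|J.2| <= mu p (free_family F n).
  apply: mu_avoid_ge => //.
    by move=> h /imsetP[f]; rewrite inE => /injectiveP finj ->; rewrite card_copy.
  move=> S HS; rewrite inE; apply/F_freeP => f finj.
  have /HS : copy f J.2 \in H by apply: imset_f; rewrite inE; apply/injectiveP.
  by apply: contra; apply: fintype.subset_trans (copyS _ _ _ JF).
rewrite mup => le; rewrite leNgt; apply/negP => pd.
have : #|H|%:R * p ^+ #|J.2| < 1 / 2.
  apply: (@le_lt_trans _ _ (n%:R ^+ #|J.1| * p ^+ #|J.2|)).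
    by rewrite ler_wpM2r ?exprn_ge0 // -natrX ler_nat.
  apply: (@lt_le_trans _ _ (n%:R ^+ #|J.1| * (1 / 2 * d) ^+ #|J.2|)).
    by rewrite ltr_pM2l ?exprn_gt0 ?ltr0n // ltrXn2r // -lt0n.
  rewrite exprMn mulrCA [_ * d ^+ _]mulrC dn mulr1.
  (* [J] has an edge, so [(1/2) ^+ #|J.2|] is at most [1/2]. *)
  have -> : #|J.2| = #|J.2|.-1.+1 by rewrite prednK.
  by rewrite exprS ler_piMr ?exprn_ile1 ?divr_ge0 // ler_pdivrMr ?mul1r ?ler1n.
by move: le; move: (_ * _) => x; clear; lra.
Qed.

(** Chebyshev: the right-hand side is the variance of the number [Z] of contained sets [h i], and on
    [A] this number is 0, at distance [m] from its mean. *)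
Lemma bernoulli_second_moment {R : realType} {X I : finType} (h : I -> {set X})
    (p : R) (A : {set {set X}}) :
  0 <= p <= 1 -> (forall S, S \in A -> forall i, ~~ (h i \subset S)) ->
  mu p A * (\sum_i p ^+ #|h i|) ^+ 2 <=
  \sum_i \sum_j (p ^+ #|h i :|: h j|%SET - p ^+ #|h i| * p ^+ #|h j|).
Proof.
move=> p01 hA; set m := \sum_i p ^+ _.
pose Z (S : {set X}) : R := \sum_i (h i \subset S)%:R.
have EZ : \sum_(S : {set X}) bernoulli_weight p S * Z S = m.
  under eq_bigr do rewrite mulr_sumr.
  by rewrite exchange_big; apply: eq_bigr => i _; rewrite sum_bernoulli_subset.
have EZ2 : \sum_(S : {set X}) bernoulli_weight p S * Z S ^+ 2 =
    \sum_i \sum_j p ^+ #|h i :|: h j|%SET.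
  have E (S : {set X}) : bernoulli_weight p S * Z S ^+ 2 =
      \sum_i \sum_j bernoulli_weight p S * (h i :|: h j \subset S)%SET%:R.
    rewrite expr2 /Z mulr_suml mulr_sumr; apply: eq_bigr => i _.
    rewrite !mulr_sumr; apply: eq_bigr => j _.
    by rewrite finset.subUset; do 2!case: (_ \subset S); rewrite ?mulr0 ?mulr1 ?mul0r ?mulr0.
  under eq_bigr do rewrite E.
  rewrite exchange_big; apply: eq_bigr => i _.
  by rewrite exchange_big; apply: eq_bigr => j _; rewrite sum_bernoulli_subset.
have -> : \sum_i \sum_j (p ^+ #|h i :|: h j|%SET - p ^+ #|h i| * p ^+ #|h j|) =
    \sum_(S : {set X}) bernoulli_weight p S * (Z S - m) ^+ 2.
  have E S : bernoulli_weight p S * (Z S - m) ^+ 2 =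
      bernoulli_weight p S * Z S ^+ 2 + (- 2 * m) * (bernoulli_weight p S * Z S)
      + m ^+ 2 * bernoulli_weight p S by ring.
  rewrite [RHS](eq_bigr _ (fun S _ => E S)) !big_split /= -!mulr_sumr.
  rewrite EZ EZ2 sum_bernoulli.
  under eq_bigr do rewrite sumrB -mulr_sumr -/m.
  by rewrite sumrB -mulr_suml -/m; ring.
rewrite muE mulr_suml; apply: ler_sum => S _; rewrite -mulrA.
rewrite ler_wpM2l ?bernoulli_weight_ge0 //.
case: (boolP (S \in A)) => SA; last by rewrite mul0r sqr_ge0.
rewrite /Z big1 ?sub0r ?sqrrN ?mul1r // => i _.
by rewrite (negbTE (hA _ SA i)).
Qed.

(** The sum factors over the vertices: at [v] the value [f v] contributes [#|U|] and the other
    values contribute 1 each, together at most [2 * #|U|]. *)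
Lemma sum_expr_agree {R : realType} {V U : finType} (f : {ffun V -> U}) :
  \sum_(g : {ffun V -> U}) #|U|%:R ^+ #|[set v | f v == g v]%SET| <=
  (2 * #|U|%:R) ^+ #|V| :> R.
Proof.
have E (g : {ffun V -> U}) : #|U|%:R ^+ #|[set v | f v == g v]%SET| =
    \prod_v (if f v == g v then #|U|%:R else 1) :> R.
  by rewrite -prodr_mem; apply: eq_bigr => v _; rewrite inE.
under eq_bigr do rewrite E.
rewrite -(bigA_distr_bigA (fun v u => if f v == u then #|U|%:R else 1)) /=.
rewrite -[leRHS]prodr_const; apply: ler_prod => v _; apply/andP; split.
  by apply: sumr_ge0 => u _; case: ifP.
apply: (@le_trans _ _ (\sum_u ((if f v == u then #|U|%:R else 0) + 1))).
  by apply: ler_sum => u _; case: ifP; rewrite ?add0r // lerDl.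
by rewrite big_split /= sumr_const -big_mkcond (big_pred1 (f v)) ?mulr_natl.
Qed.

(** The vertices [iota (v, u)] form the class of [v]. The hypothesis on [D] bounds below the
    expected number of placements of each spanned subgraph with an edge, and the variance is then at
    most [2 ^+ #|V| / D] times the squared mean. *)
Lemma mu_free_family_le {R : realType} {V U : finType} (F : graph V) (n : nat)
    (iota : V * U -> 'I_n) (p D : R) :
  injective iota -> (0 < #|U|)%N -> 0 < p <= 1 -> 0 < D ->
  (forall A : {set V}, [set e in F | val e \subset A]%SET != finset.set0 ->
    D <= #|U|%:R ^+ #|A| * p ^+ #|[set e in F | val e \subset A]%SET|) ->
  mu p (free_family F n) * D <= 2 ^+ #|V|.
Proof.
move=> iinj U0 /andP[p0 p1] D0 HD.
pose FA (A : {set V}) : graph V := [set e in F | val e \subset A]%SET.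
pose f (phi : {ffun V -> U}) : {ffun V -> 'I_n} := [ffun v => iota (v, phi v)].
have finj phi : injective (f phi).
  by move=> v w; rewrite !ffunE => /iinj[].
pose h phi := copy (f phi) F.
have hF phi : #|h phi| = #|F| by apply: card_copy.
have p01 : 0 <= p <= 1 by rewrite (ltW p0).
have avoid S : S \in free_family F n -> forall phi, ~~ (h phi \subset S).
  by rewrite inE => /F_freeP free phi; apply: free; apply: finj.
have := @bernoulli_second_moment R _ _ h p (free_family F n) p01 avoid.
rewrite (_ : \sum_i p ^+ #|h i| = #|U|%:R ^+ #|V| * p ^+ #|F|); last first.
  by under eq_bigr do rewrite hF; rewrite sumr_const card_ffun -natrX mulr_natl.
set M := _ * p ^+ #|F| => moment.
have M0 : 0 < M by rewrite mulr_gt0 ?exprn_gt0 ?ltr0n.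
pose agree (phi psi : {ffun V -> U}) := [set v | phi v == psi v]%SET.
(* An end of a common edge reveals its class [v] and its position there, so both placements put [v]
   at the same position. *)
have hI phi psi : (#|h phi :&: h psi|%SET <= #|FA (agree phi psi)|)%N.
  rewrite -(card_copy (f phi) (FA (agree phi psi)) (finj phi)).
  apply: subset_leq_card; apply/fintype.subsetP => x.
  rewrite inE => /andP[/copyP[e eF xe] /copyP[e' _ xe']].
  apply/copyP; exists e => //; rewrite inE eF /=; apply/fintype.subsetP => v ve.
  have : f phi v \in val x by rewrite xe imset_f.
  rewrite xe' => /imsetP[w _]; rewrite !ffunE => /iinj[-> E].
  by rewrite inE E.
(* The right-hand side is kept also for pairs sharing no edge: its sum over all
   pairs then factors over the vertices. *)
have term_le phi psi : p ^+ #|h phi :|: h psi|%SET - p ^+ #|F| * p ^+ #|F| <=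
    p ^+ (2 * #|F|) / D * #|U|%:R ^+ #|agree phi psi|.
  have := cardsUI (h phi) (h psi); rewrite !hF addnn -mul2n => cUI.
  rewrite -exprD addnn -mul2n; have := hI phi psi.
  have [E0|E0] := eqVneq (FA (agree phi psi)) finset.set0.
    rewrite E0 cards0 leqn0 => /eqP I0; move: cUI; rewrite I0 addn0 => ->.
    by rewrite subrr !mulr_ge0 ?exprn_ge0 ?invr_ge0 // ltW.
  move=> le; apply: (@le_trans _ _ (p ^+ #|h phi :|: h psi|%SET)).
    by rewrite gerDl oppr_le0 exprn_ge0 // ltW.
  rewrite mulrAC ler_pdivlMr // -cUI exprD -mulrA ler_pM2l ?exprn_gt0 //.
  apply: le_trans (HD _ E0) _; rewrite [leRHS]mulrC ler_wpM2l ?exprn_ge0 //.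
  by apply: ler_wiXn2l => //; apply: ltW.
have total : \sum_phi \sum_psi
    (p ^+ #|h phi :|: h psi|%SET - p ^+ #|F| * p ^+ #|F|) <= 2 ^+ #|V| * M ^+ 2 / D.
  apply: (@le_trans _ _ (\sum_(phi : {ffun V -> U})
      p ^+ (2 * #|F|) / D * (2 * #|U|%:R) ^+ #|V|)).
    apply: ler_sum => phi _.
    apply: le_trans (_ : \sum_psi p ^+ (2 * #|F|) / D *
      #|U|%:R ^+ #|agree phi psi| <= _); first exact: ler_sum.
    rewrite -mulr_sumr ler_wpM2l ?sum_expr_agree // mulr_ge0 ?exprn_ge0 ?ltW //.
    by rewrite invr_gt0.
  rewrite sumr_const card_ffun -[leLHS]mulr_natl natrX /M !exprMn mulnC exprM.
  rewrite le_eqVlt; apply/orP; left; apply/eqP.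
  move: (_ ^+ #|V|) (p ^+ #|F|) (2 ^+ #|V|) => a b c; clear -D0.
  by field; rewrite gt_eqF.
have {}total : mu p (free_family F n) * M ^+ 2 <= 2 ^+ #|V| * M ^+ 2 / D.
  apply: le_trans moment (le_trans _ total).
  by apply: ler_sum => phi _; apply: ler_sum => psi _; rewrite !hF.
by rewrite ler_pdivlMr // mulrAC ler_pM2r ?exprn_gt0 in total.
Qed.

Lemma powR_density_ge {R : realType} (m : R) (n k l : nat) :
  0 < m -> (0 < n)%N -> k%:R <= m * l%:R ->
  1 <= (n%:R `^ (- 1 / m)) ^+ k * n%:R ^+ l.
Proof.
move=> m0 n0 kl; have n0' : 0 < n%:R :> R by rewrite ltr0n.
rewrite -powR_mulrn ?powR_ge0 // -powRrM -[n%:R ^+ l]powR_mulrn ?ler0n //.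
rewrite -powRD; last by rewrite (gt_eqF n0') implybT.
rewrite -[leLHS](powRr0 n%:R) ler_powR ?ler1n //.
rewrite -(pmulr_rge0 _ m0) mulrDr mulrA mulrCA mulN1r mulfV ?gt_eqF //.
by rewrite mulN1r addrC subr_ge0.
Qed.

Lemma threshold_free_family_le {R : realType} {V : finType} (F : graph V) :
  (0 < #|F|)%N -> (0 < #|V|)%N -> exists2 C : R, 0 < C & forall (n : nat) (p : R),
    (#|V| <= n)%N -> 0 <= p <= 1 -> mu p (free_family F n) = 1 / 2 ->
    p <= C * n%:R `^ (- 1 / density_m R F).
Proof.
move=> F0 V0; have [m0 _] := density_m_attained R F F0 V0.
set m := density_m R F in m0 *.
(* [D] makes [1/2 * D] exceed [2 ^+ #|V|], the contradiction sought; [B] pays for replacing [n] by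
   the class size [k] in [n ^+ #|A|]. *)
pose D : R := 4 * 2 ^+ #|V|; pose B : R := (2 * #|V|%:R) ^+ #|V|.
have D1 : 1 <= D by rewrite mulr_ege1 ?exprn_ege1 // ler1n.
have v1 : 1 <= 2 * #|V|%:R :> R by rewrite mulr_ege1 // ler1n.
have B1 : 1 <= B by rewrite exprn_ege1.
have C1 : 1 <= D * B by rewrite mulr_ege1.
have B0 : 0 < B by apply: lt_le_trans B1.
have D0 : 0 < D by apply: lt_le_trans D1.
exists (D * B); first by rewrite mulr_gt0.
move=> n p Vn /andP[p0 p1] mup; rewrite leNgt; apply/negP => pC.
have n0 : (0 < n)%N by apply: leq_trans Vn.
have /andP[d0 d1] := powR_density_bound m n m0 n0.
have dn k l := powR_density_ge m n k l m0 n0.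
set d := n%:R `^ (- 1 / m) in d0 d1 dn pC.
pose k := (n %/ #|V|)%N.
have k0 : (0 < k)%N by rewrite divn_gt0.
(* Rounding down loses at most a factor 2, as [n < (k + 1) * #|V|] and [k >= 1]. *)
have nk : (n <= 2 * #|V| * k)%N.
  have := ltn_ceil n V0; rewrite -/k => /ltnW/leq_trans; apply.
  by rewrite mulnC -mulnA mulnCA leq_mul2l mul2n -addnn -addn1 leq_add2l k0 orbT.
have VU : (#|{: V * 'I_k}| <= n)%N.
  by rewrite card_prod card_ord mulnC leq_divM.
pose iota (x : V * 'I_k) : 'I_n := widen_ord VU (enum_rank x).
have iinj : injective iota.
  by move=> x y /(congr1 val)/= /val_inj/enum_rank_inj.
have pp : 0 < p by apply: le_lt_trans pC; rewrite !mulr_ge0 // ltW.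
have := @mu_free_family_le R V 'I_k F n iota p D iinj.
rewrite card_ord mup pp p1 => /(_ k0 isT D0) main.
suff : 1 / 2 * D <= 2 ^+ #|V|.
  have : 0 < 2 ^+ #|V| :> R by rewrite exprn_gt0.
  by rewrite /D; move: (2 ^+ #|V|) => x; clear; lra.
apply: main => A; set E := finset.finset _ => /set0Pn[e eE].
have AE : #|E|%:R <= m * #|A|%:R.
  apply: (density_m_ge R F (A, E)); last first.
    move: eE; rewrite inE => /andP[_ eA]; apply: leq_trans (subset_leq_card eA).
    by rewrite (eqP (valP e)).
  rewrite /subgraph /=; apply/andP; split.
    by apply/fintype.subsetP => x; rewrite inE => /andP[].
  by apply/forall_inP => x; rewrite inE => /andP[].
have E0 : (0 < #|E|)%N by apply/card_gt0P; exists e.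
have DB0 : 0 <= D * B * d by rewrite !mulr_ge0 // ltW.
(* [E] is non-empty, so at least one full factor [D * B >= 1] is available. *)
have pE : D * B * d ^+ #|E| <= p ^+ #|E|.
  apply: (@le_trans _ _ ((D * B * d) ^+ #|E|)); last first.
    by apply: lerXn2r; rewrite ?nnegrE //; apply: ltW.
  rewrite exprMn ler_wpM2r ?exprn_ge0 ?(ltW d0) //.
  by rewrite -[leLHS]expr1 ler_weXn2l.
have nA : n%:R ^+ #|A| <= B * k%:R ^+ #|A|.
  apply: (@le_trans _ _ ((2 * #|V|%:R * k%:R) ^+ #|A|)).
    by rewrite lerXn2r ?nnegrE ?mulr_ge0 // -!natrM ler_nat.
  by rewrite exprMn ler_wpM2r ?exprn_ge0 // ler_weXn2l // max_card.
rewrite -(ler_pM2r B0); apply: (@le_trans _ _ (D * B * (d ^+ #|E| * n%:R ^+ #|A|))).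
  by rewrite ler_peMr ?mulr_ge0 ?(ltW B0) ?(ltW D0) // dn.
apply: (@le_trans _ _ (p ^+ #|E| * (B * k%:R ^+ #|A|))); last first.
  by rewrite le_eqVlt; apply/orP; left; apply/eqP; rewrite mulrC -mulrA mulrC.
rewrite mulrA ler_pM ?mulr_ge0 ?exprn_ge0 ?(ltW B0) ?(ltW D0) ?(ltW d0) //.
Qed.

Theorem mainTheorem2 (R : realType) (V : finType) (F : graph V)
    (F_deg : (2 <= max_degree F)%N) :
  [/\ (fun n : nat => expectation_threshold R (free_family F n)) \is
        'Omega_\oo (fun n : nat => n%:R `^ (- 1 / density_m2 R F) : R),
      (fun n : nat => fractional_expectation_threshold R (free_family F n)) \is
        'Omega_\oo (fun n : nat => n%:R `^ (- 1 / density_m2 R F) : R)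
    & (fun n : nat => threshold R (free_family F n)) \is
        'Theta_\oo (fun n : nat => n%:R `^ (- 1 / density_m R F) : R)].
Proof.
have [F2 V3] := max_degree_ge2 F F_deg.
have F0 : (0 < #|F|)%N by apply: ltnW.
have V0 : (0 < #|V|)%N by apply: ltn_trans V3.
have n0 n : (#|V| <= n)%N -> (0 < n)%N by apply: leq_trans.
have norm n x : `|n%:R `^ x : R| = n%:R `^ x.
  by rewrite ger0_norm // powR_ge0.
have [c c0 lower] := @weighted_cover_free_family_ge R V F F_deg.
split.
- rewrite qualifE; apply/asboolP; exists c => //.
  (* From [#|V|] vertices on, the complete graph contains [F], so the family is proper and the
     infimum is attained. *)
  exists #|V| => // n /= Vn; rewrite norm //.
  have cov := @expectation_thresholdP R _ _ (setT_free_family F n Vn).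
  have [/andP[q0 _] _] := cov; rewrite ger0_norm //.
  by apply: lower cov; apply: n0.
- rewrite qualifE; apply/asboolP; exists c => //.
  exists #|V| => // n /= Vn; rewrite norm //.
  have cov := @fractional_expectation_thresholdP R _ _ (setT_free_family F n Vn).
  have [/andP[q0 _] _] := cov; rewrite ger0_norm //.
  by apply: lower cov; apply: n0.
have [C C0 upper] := @threshold_free_family_le R V F F0 V0.
rewrite qualifE; apply/asboolP; exists (1 / 2, C); first by rewrite /= C0 divr_gt0.
exists #|V| => // n /= Vn; rewrite norm //.
have [p01 mup] := @thresholdP R _ _ (set0_free_family F n F0)
  (setT_free_family F n Vn).
have /andP[p0 _] := p01; rewrite ger0_norm //; split; last exact: upper mup.
exact: threshold_free_family_ge (n0 n Vn) p01 mup.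
Qed.
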